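(* Let $r \ge 3$ be an integer. If $G$ is a connected graph of order $n$ with maximum degree $\Delta(G) \le r$, then \[ \gamma_c(G) \ge \frac{n-2}{r-1}, \] with equality if and only if $G$ has a spanning tree that is a $(1,r)$-tree.
   Context: All graphs are finite, simple and undirected. A connected dominating set of $G$ is a set $S \subseteq V(G)$ such that every vertex not in $S$ has a neighbor in $S$ and $G[S]$ is connected; $\gamma_c(G)$ is the minimum cardinality of a connected dominating set of $G$. For $r \ge 3$, a $(1,r)$-tree is a tree in which every vertex has degree $1$ or $r$.
   Formalization: The equality characterization is stated for order n ≠ 2, since it fails for G = K_2, which is itself a (1,r)-tree but has connected domination number 1 rather than 0; the inequality is stated for all connected G. *)

(* Defs.v *)
From mathcomp Require Import all_boot.

Set Implicit Arguments.
Unset Strict Implicit.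
Unset Printing Implicit Defensive.

Record sgraph (V : finType) := SGraph {
  adj :> rel V;
  adj_sym : symmetric adj;
  adj_irrefl : irreflexive adj
}.

Section Graphs.

Variables (V : finType) (G : sgraph V).

Definition degree (x : V) : nat := #|[set y | G x y]|.

Definition max_degree : nat := \max_(x : V) degree x.

(* The graph with no vertices is not connected. *)
Definition connected_graph : bool :=
  (0 < #|V|) && [forall x, forall y, connect G x y].

Definition acyclic : Prop :=
  forall c : seq V, 2 < size c -> ~ ucycle G c.

Definition is_tree : Prop := connected_graph /\ acyclic.

Definition is_1r_tree (r : nat) : Prop :=
  is_tree /\ forall x : V, degree x = 1 \/ degree x = r.

End Graphs.

Section Induced.

Variables (V : finType) (G : sgraph V) (S : {set V}).

Definition induced_adj : rel {x : V | x \in S} :=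
  fun x y => G (val x) (val y).

Lemma induced_adj_sym : symmetric induced_adj.
Proof. by move=> x y; apply: adj_sym. Qed.

Lemma induced_adj_irrefl : irreflexive induced_adj.
Proof. by move=> x; apply: adj_irrefl. Qed.

Definition induced : sgraph {x : V | x \in S} :=
  SGraph induced_adj_sym induced_adj_irrefl.

Definition dominating : bool :=
  [forall x, (x \notin S) ==> [exists y in S, G x y]].

Definition connected_dominating : bool :=
  dominating && connected_graph induced.

End Induced.

(* Junk value #|V| when G has no connected dominating set, i.e. when G is not
   connected; see gamma_cP. *)
Definition gamma_c (V : finType) (G : sgraph V) : nat :=
  #|[arg min_(S < [set: V] | connected_dominating G S) #|S|]|.

Lemma connected_dominatingT (V : finType) (G : sgraph V) :
  connected_graph G -> connected_dominating G [set: V].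
Proof.
case/andP=> V_gt0 /forallP Gconn; apply/andP; split.
  by apply/forallP=> x; rewrite inE.
apply/andP; split; first by rewrite card_sig cardsT.
apply/forallP=> x; apply/forallP=> y.
have /connectP[p] := forallP (Gconn (val x)) (val y).
elim: p x => [|z p IHp] x /=; first by move=> _ /val_inj ->.
case/andP=> xz zp yE.
apply: connect_trans (IHp (exist _ z (in_setT z)) zp yE).
by apply: connect1.
Qed.

Lemma gamma_cP (V : finType) (G : sgraph V) :
  connected_graph G ->
  (exists2 S, connected_dominating G S & #|S| = gamma_c G) /\
  (forall S, connected_dominating G S -> gamma_c G <= #|S|).
Proof.
move=> /connected_dominatingT GT; rewrite /gamma_c.
by case: arg_minnP => // S domS minS; split; first exists S.
Qed.

Definition subgraph (V : finType) (H G : sgraph V) : Prop :=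
  subrel H G.

Definition has_spanning_1r_tree (V : finType) (G : sgraph V) (r : nat) : Prop :=
  exists H : sgraph V, subgraph H G /\ is_1r_tree H r.

(* On two vertices G is K_2, which is itself a (1,r)-tree, while gamma_c = 1
   differs from (2 - 2) / (r - 1) = 0. *)
Lemma order2_spanning_1r_tree (V : finType) (G : sgraph V) (r : nat) :
  connected_graph G -> #|V| = 2 -> 0 < gamma_c G /\ has_spanning_1r_tree G r.
Proof.
move=> Gc V2; split.
  have [[S /andP[_ /andP[S_gt0 _]] <-] _] := gamma_cP Gc.
  by rewrite card_sig in S_gt0.
exists G; split=> //; split; first split=> //.
  move=> c c_gt2 /andP[_ /card_uniqP Uc].
  by have := max_card (mem c); rewrite Uc V2 leqNgt c_gt2.
move=> x; left; apply/eqP; rewrite eqn_leq; apply/andP; split.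
  have /subset_leq_card : [set y | G x y] \subset [set~ x].
    by apply/subsetP=> y; rewrite !inE; apply: contraTneq => ->; rewrite adj_irrefl.
  by rewrite cardsC1 V2.
have : 0 < #|[set~ x]| by rewrite cardsC1 V2.
case/card_gt0P=> y; rewrite !inE => ynx.
have /andP[_ /forallP/(_ x)/forallP/(_ y)/connectP[[|z p] /=]] := Gc.
  by move=> _ yx; rewrite yx eqxx in ynx.
by case/andP=> xz _ _; apply/card_gt0P; exists z; rewrite inE.
Qed.

(* Main.v *)
Require Import Defs.
From mathcomp Require Import all_boot all_order all_algebra.
From mathcomp Require Import zify.
Import Order.TTheory GRing.Theory Num.Theory.

(** A connected graph on n vertices has degree sum at least 2(n - 1), with
    equality exactly for trees: orient every non-root vertex towards a neighbour
    closer to the root and count the resulting arcs in both directions.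

    Given a connected dominating set S, attach each vertex outside S to one
    neighbour in S and keep the edges inside S.  This spanning connected subgraph
    has degree 1 outside S and at most r on S, so
    2(n - 1) <= (n - |S|) + r |S|, i.e. n - 2 <= (r - 1)|S|, and equality makes
    it a (1,r)-tree.  Conversely, the non-leaves of a (1,r)-tree of order at
    least 3 form a connected dominating set, of size (n - 2)/(r - 1) by the same
    count. *)

Set Implicit Arguments.
Unset Strict Implicit.
Unset Printing Implicit Defensive.

(** * Degree sums of connected graphs and of trees *)

Section DegreeSum.

Variables (V : finType) (G : sgraph V).

Lemma connected_graphP :
  reflect (0 < #|V| /\ forall x y, connect G x y) (connected_graph G).
Proof.
apply: (iffP andP) => -[V_gt0 Gc]; split=> //.
  by move=> x y; apply: (forallP (forallP Gc x)).
by apply/forallP=> x; apply/forallP.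
Qed.

(** Take for [d x] the length of a shortest walk from [x] to [root]; the second vertex of such a
    walk shows that a strictly closer neighbour [p x] exists. *)
Lemma connected_parent (root : V) :
  connected_graph G ->
  exists d : V -> nat, exists p : V -> V,
    forall x, x != root -> G x (p x) /\ d (p x) < d x.
Proof.
case/connected_graphP=> _ Gc.
pose P x n := [exists t : n.-tuple V, path G x t && (last x t == root)].
have exP x : exists n, P x n.
  have /connectP[q Gq qE] := Gc x root.
  exists (size q); apply/existsP; exists (in_tuple q).
  by rewrite /= Gq -qE eqxx.
pose d x := ex_minn (exP x).
pose p x := odflt x [pick y | G x y && (d y < d x)].
exists d, p => x xNroot; rewrite /p; case: pickP => [y /andP[] //|noy].
have: P x (d x) by rewrite /d; case: ex_minnP.
case/existsP=> t; have := size_tuple t; case: (tval t) => [|y q] /=.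
  by rewrite (negPf xNroot).
move=> szq /andP[/andP[xy yq] qlast]; have := noy y; rewrite xy -szq ltnS /=.
suff -> : d y <= size q by [].
rewrite /d; case: ex_minnP => m _; apply.
by apply/existsP; exists (in_tuple q); rewrite /= yq.
Qed.

Definition arcs : {set V * V} := [set a | G a.1 a.2].

Lemma card_arcs : #|arcs| = \sum_x degree G x.
Proof.
under [RHS]eq_bigr do rewrite /degree -sum1dep_card.
by rewrite pair_big_dep sum1dep_card.
Qed.

Section ParentArcs.

Variables (root : V) (d : V -> nat) (p : V -> V).
Hypothesis parentP : forall x, x != root -> G x (p x) /\ d (p x) < d x.

Definition parent_arcs : {set V * V} :=
  [set (x, p x) | x in [set~ root]] :|: [set (p x, x) | x in [set~ root]].

Lemma parent_arcs_sub : parent_arcs \subset arcs.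
Proof.
apply/subsetP=> a; rewrite !inE => /orP[] /imsetP[x]; rewrite !inE;
  move=> /parentP[xp _] -> //=; by rewrite adj_sym.
Qed.

(** The two orientations do not overlap: a common arc would make two vertices parents of each other,
    so [d] would decrease both ways. *)
Lemma card_parent_arcs : #|parent_arcs| = 2 * #|V|.-1.
Proof.
rewrite /parent_arcs cardsU !card_in_imset ?cardsC1; first last.
- by move=> x y _ _ [].
- by move=> x y _ _ [].
suff -> : [set (x, p x) | x in [set~ root]] :&: [set (p x, x) | x in [set~ root]]
          = set0 by rewrite cards0; lia.
apply/setP=> a; rewrite !inE; apply/negP=> /andP[/imsetP[x + ->] /imsetP[y]].
rewrite !inE => /parentP[_ dx] /parentP[_ dy] [xE yE].
by move: dx dy; rewrite yE -xE => /ltn_trans h /h; rewrite ltnn.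
Qed.

End ParentArcs.

Lemma connected_degree_sum :
  connected_graph G -> 2 * #|V|.-1 <= \sum_x degree G x.
Proof.
move=> Gc; have [/card_gt0P[root _] _] := connected_graphP Gc.
have [d [p dpP]] := connected_parent root Gc.
rewrite -(card_parent_arcs dpP) -card_arcs subset_leq_card //.
exact: parent_arcs_sub dpP.
Qed.

Lemma degree_sum_acyclic :
  connected_graph G -> \sum_x degree G x = 2 * #|V|.-1 -> acyclic G.
Proof.
move=> Gc sumE c c_gt2 /andP[Gcyc Uc].
have [/card_gt0P[root _] _] := connected_graphP Gc.
have [d [p dpP]] := connected_parent root Gc.
(* Inclusion together with equal cardinality leaves no arc of [G] besides the parent arcs. *)
have arcsE : parent_arcs root p = arcs.
  apply/eqP; rewrite eqEcard (parent_arcs_sub dpP) card_arcs sumE.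
  by rewrite (card_parent_arcs dpP) /=.
have x0c : head root c \in c.
  by case: c c_gt2 {Gcyc Uc} => //= x q _; rewrite mem_head.
(* At a vertex of the cycle farthest from the root both neighbours along the
   cycle have to be its parent. *)
case: (arg_maxnP d x0c) => x xc xmax.
have parentE y : y \in c -> G x y -> y = p x.
  move=> yc xy; have : (x, y) \in parent_arcs root p by rewrite arcsE inE.
  rewrite inE => /orP[] /imsetP[z]; rewrite !inE => zr [xE yE]; first by rewrite xE.
  by have [_] := dpP z zr; rewrite -xE -yE ltnNge => /negP[]; apply: xmax.
have nE : next c x = p x by apply: parentE; rewrite ?mem_next // next_cycle.
have pE : prev c x = p x.
  by apply: parentE; rewrite ?mem_prev // adj_sym prev_cycle.
(* Two steps along [c] now lead from [x] back to [x], although [c] has at least three distinct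
   vertices. *)
have := next_prev Uc x; rewrite pE -nE.
have [i q cE] := rot_to xc; rewrite -!(next_rot i Uc) cE.
move: Uc c_gt2; rewrite -(rot_uniq i) -(size_rot i) {}cE.
case: q => [|y [|z q]] //= /and3P[+ _ _] _; rewrite !inE !negb_or eqxx.
case/and3P=> xy xz _; rewrite eq_sym (negPf xy) eqxx => /eqP.
by rewrite eq_sym (negPf xz).
Qed.

Lemma tree_degree_sum : is_tree G -> \sum_x degree G x = 2 * #|V|.-1.
Proof.
case=> Gc Gac; have [/card_gt0P[root _] _] := connected_graphP Gc.
have [d [p dpP]] := connected_parent root Gc.
apply/eqP; rewrite eqn_leq connected_degree_sum // andbT.
rewrite -(card_parent_arcs dpP) -card_arcs subset_leq_card //.
apply/subsetP=> -[x y]; rewrite inE /= => xy; apply/negPn/negP=> xyN.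
(* Parent arcs still connect x and y when the edge xy is deleted, which closes
   a cycle. *)
pose e := [rel u v | G u v && ((u, v) \notin [set (x, y); (y, x)])].
have esym : symmetric e.
  by move=> u v; rewrite /= adj_sym !inE !xpair_eqE orbC ![(u == _) && _]andbC.
have toroot z : connect e z root.
  have [n] := ubnP (d z); elim: n z => // n IHn z dz.
  have [->|zr] := eqVneq z root; first exact: connect0.
  have [zp dp] := dpP z zr.
  apply: (connect_trans (connect1 _) (IHn (p z) (leq_trans dp dz))).
  (* If the step from [z] to [p z] used the deleted edge, [(x, y)] would be a parent arc in one of
     the two orientations. *)
  rewrite /= zp; apply: contra xyN; rewrite !inE => /orP[] /eqP[zE pE].
    by apply/orP; left; apply/imsetP; exists x; rewrite ?inE -zE ?pE.
  by apply/orP; right; apply/imsetP; exists y; rewrite ?inE -zE ?pE.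
have : connect e x y.
  by apply: connect_trans (toroot x) _; rewrite (sym_connect_sym esym).
case/connectP=> q0 /shortenP[q xq Uq _] yE.
(* An empty path gives a loop and a single step is the deleted edge; any longer path closes up
   through the edge [xy]. *)
case: q => [|z [|w q]] in xq Uq yE.
- by move: xy; rewrite yE adj_irrefl.
- by move: xq; rewrite /= yE !inE eqxx /= andbF.
apply: (Gac [:: x, z, w & q]) => //; apply/andP; split=> //.
have Gq : path G x [:: z, w & q] by apply: sub_path xq => u v /andP[].
by rewrite [cycle _ _]rcons_path Gq -yE adj_sym.
Qed.

End DegreeSum.

(** * The spanning subgraph built from a connected dominating set *)

Section Attach.

Variables (V : finType) (G : sgraph V) (S : {set V}) (f : V -> V).
Hypothesis fP : forall x, x \notin S -> f x \in S /\ G x (f x).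

Definition attach_adj : rel V := fun x y =>
  G x y && [|| (x \in S) && (y \in S), (x \notin S) && (y == f x)
             | (y \notin S) && (x == f y)].

Lemma attach_sym : symmetric attach_adj.
Proof.
move=> x y; rewrite /attach_adj adj_sym [(y \in S) && _]andbC; congr (_ && (_ || _)).
by rewrite orbC.
Qed.

Lemma attach_irrefl : irreflexive attach_adj.
Proof. by move=> x; rewrite /attach_adj adj_irrefl. Qed.

Definition attach : sgraph V := SGraph attach_sym attach_irrefl.

Lemma attach_sub : subgraph attach G.
Proof. by move=> x y /andP[]. Qed.

Lemma degree_attach_out x : x \notin S -> degree attach x = 1.
Proof.
move=> xS; have [fS xf] := fP xS.
rewrite /degree -(cards1 (f x)); apply: eq_card => y.
rewrite !inE /= /attach_adj (negPf xS) /=.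
apply/idP/eqP => [/andP[_ /orP[/eqP//|/andP[yS /eqP xE]]]|->].
  (* Chosen neighbours lie in [S], so [x] is not one of them. *)
  by have [] := fP yS; rewrite -xE (negPf xS).
by rewrite xf eqxx.
Qed.

(** Every vertex reaches [S] in at most one step, and walks of [induced G S] survive because all
    edges inside [S] are kept. *)
Lemma attach_connected : connected_graph (induced G S) -> connected_graph attach.
Proof.
case/connected_graphP=> S_gt0 Sc.
have toS x : exists2 s, s \in S & connect attach x s.
  have [xS|xS] := boolP (x \in S); first by exists x.
  have [fS xf] := fP xS; exists (f x) => //; apply: connect1.
  by rewrite /= /attach_adj xf xS eqxx orbT.
have inS x y : x \in S -> y \in S -> connect attach x y.
  move=> xS yS; have /connectP[q] := Sc (exist _ x xS) (exist _ y yS).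
  move=> xq /(congr1 val) /= ->.
  rewrite -[x]/(val (exist (fun z => z \in S) x xS)).
  elim: q (exist _ x xS) xq => [|z q IHq] u //= /andP[uz zq].
  apply: connect_trans (IHq z zq); apply: connect1.
  by rewrite /= /attach_adj (valP u) (valP z) [G _ _]uz.
apply/connected_graphP; split.
  by case/card_gt0P: S_gt0 => x _; apply/card_gt0P; exists (val x).
move=> x y; have [s sS xs] := toS x; have [t tS yt] := toS y.
apply: connect_trans xs (connect_trans (inS s t sS tS) _).
by rewrite (sym_connect_sym attach_sym).
Qed.

End Attach.

Lemma degree_subgraph (V : finType) (H G : sgraph V) x :
  subgraph H G -> degree H x <= degree G x.
Proof.
by move=> HG; apply/subset_leq_card/subsetP=> y; rewrite !inE; apply: HG.
Qed.

Lemma connected_dominating_attach (V : finType) (G : sgraph V) (S : {set V}) :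
  connected_dominating G S ->
  exists2 H : sgraph V, subgraph H G /\ connected_graph H
    & forall x, x \notin S -> degree H x = 1.
Proof.
case/andP=> /forallP Sdom Sc.
pose f x := odflt x [pick y in S | G x y].
have fP x : x \notin S -> f x \in S /\ G x (f x).
  move=> xS; rewrite /f; case: pickP => [y /andP[]//|noy].
  have /existsP[y] := implyP (Sdom x) xS; by rewrite noy.
exists (attach G S f); last exact: degree_attach_out.
by split; [exact: attach_sub | exact: attach_connected].
Qed.

(** * The lower bound on connected dominating sets and its equality case *)

Lemma sum_split_card (V : finType) (S : {set V}) (F : V -> nat) :
  (forall x, x \notin S -> F x = 1) ->
  \sum_x F x + #|S| = \sum_(x in S) F x + #|V|.
Proof.
move=> F1; rewrite (bigID (mem S)) /= (eq_bigr (fun=> 1) F1) sum1_card.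
rewrite -(cardsC S) -addnA; congr (_ + _); rewrite addnC; congr (_ + _).
by apply: eq_card => x; rewrite !inE.
Qed.

Lemma connected_dominating_card (V : finType) (G : sgraph V) (S : {set V}) r :
  0 < r -> (forall x, degree G x <= r) -> connected_dominating G S ->
  #|V| <= r.-1 * #|S| + 2.
Proof.
move=> r_gt0 Gr /connected_dominating_attach[H [HG Hc] H1].
have := connected_degree_sum Hc; have := sum_split_card H1.
have : \sum_(x in S) degree H x <= #|S| * r.
  rewrite -sum_nat_const; apply: leq_sum => x _.
  exact: leq_trans (degree_subgraph x HG) (Gr x).
by case: r r_gt0 {Gr} => //= r _; rewrite mulnS [#|S| * r]mulnC; lia.
Qed.

(** The degree sum of [H] is squeezed between equal bounds: the lower one being tight makes [H] a
    tree, the upper one forces degree [r] at each vertex of [S]. *)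
Lemma connected_dominating_tight (V : finType) (G : sgraph V) (S : {set V}) r :
  0 < r -> (forall x, degree G x <= r) -> connected_dominating G S ->
  #|V| = r.-1 * #|S| + 2 -> has_spanning_1r_tree G r.
Proof.
move=> r_gt0 Gr /connected_dominating_attach[H [HG Hc] H1] VE.
have Hr x : degree H x <= r by apply: leq_trans (degree_subgraph x HG) (Gr x).
have sumS : \sum_(x in S) degree H x <= \sum_(x in S) r by apply: leq_sum.
have rS : \sum_(x in S) r = r.-1 * #|S| + #|S|.
  by rewrite sum_nat_const mulnC -{1}(prednK r_gt0) mulSn addnC.
have lb := connected_degree_sum Hc; have eqs := sum_split_card H1.
exists H; split=> //; split; first split=> //.
  by apply: degree_sum_acyclic => //; lia.
move=> x; have [xS|/H1] := boolP (x \in S); [right | by left].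
have : \sum_(x in S) degree H x = \sum_(x in S) r by lia.
move/eqP; rewrite (leqif_sum (C := fun x => degree H x == r)); last first.
  by move=> y _; split.
by move/forall_inP/(_ x xS)/eqP.
Qed.

(** * Non-leaves as a connected dominating set *)

Lemma nonleaves_connected_dominating (V : finType) (G H : sgraph V) :
  subgraph H G -> connected_graph H -> 2 < #|V| ->
  connected_dominating G [set x | 1 < degree H x].
Proof.
move=> HG /connected_graphP[V_gt0 Hc] V_gt2; set S := [set x | _].
have deg_gt1 x y z : H x y -> H x z -> y != z -> x \in S.
  move=> xy xz yz; rewrite inE; apply/card_gt1P.
  by exists y, z; rewrite ?inE.
have domS x : x \notin S -> exists2 y, y \in S & H x y.
  move=> xS.
  have /card_gt0P[y] : 0 < #|[set~ x]| by rewrite cardsC1; lia.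
  rewrite !inE => yx; have /connectP[[|z q] /=] := Hc x y.
    by move=> _ yE; rewrite yE eqxx in yx.
  case/andP=> xz _ _; exists z => //; apply/negPn/negP=> zS.
  (* Two adjacent vertices outside [S] have no further neighbours, so by connectedness they would be
     the whole graph. *)
  have clos u v : H u v -> u \in [set x; z] -> v \in [set x; z].
    rewrite !inE => uv /orP[] /eqP uE; move: uv; rewrite uE => uv.
    - have [_|vz] := eqVneq v z; first by rewrite orbT.
      by rewrite (deg_gt1 x v z) in xS.
    - have [//|vx] := eqVneq v x.
      by rewrite (deg_gt1 z v x) // adj_sym in zS.
  have : [set: V] \subset [set x; z].
    apply/subsetP=> w _; have /connectP[s] := Hc x w.
    have : x \in [set x; z] by rewrite !inE eqxx.
    elim: s {1 3 4}x => [|u s IHs] v vxz /=; first by move=> _ ->.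
    by case/andP=> vu us; apply: IHs => //; apply: clos vu vxz.
  move/subset_leq_card; rewrite cardsT leqNgt.
  by rewrite (leq_ltn_trans _ V_gt2) // cards2; case: (_ == _).
have path_conn q x (xS : x \in S) y (yS : y \in S) :
    path H x q -> uniq (x :: q) -> y = last x q ->
    connect (induced G S) (exist _ x xS) (exist _ y yS).
  elim: q x xS => [|z q IHq] x xS /=.
    by move=> _ _ yE; have -> : exist (fun z => z \in S) x xS = exist _ y yS
      by apply: val_inj.
  case/andP=> xz zq /andP[xNq Uq] yE.
  (* Either [z] is the endpoint [y], or it is interior to a simple path and has two distinct
     neighbours there. *)
  have zS : z \in S.
    case: q zq xNq yE {IHq Uq} => [|w q] /=; first by move=> _ _ <-.
    case/andP=> zw _; rewrite !in_cons !negb_or => /and3P[_ xw _] _.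
    by apply: (deg_gt1 z x w); rewrite // adj_sym.
  apply: connect_trans (IHq z zS zq Uq yE); apply: connect1.
  exact: HG.
apply/andP; split.
  apply/forallP=> x; apply/implyP=> /domS[y yS xy].
  by apply/existsP; exists y; rewrite yS HG.
apply/connected_graphP; split.
  case/card_gt0P: V_gt0 => x _; rewrite card_sig; apply/card_gt0P.
  by have [xS|/domS[y]] := boolP (x \in S); [exists x | exists y].
move=> [x xS] [y yS]; have /connectP[q /shortenP[q' xq Uq _] yE] := Hc x y.
exact: path_conn xq Uq yE.
Qed.

(** Since [1 < r], the set [S] collects exactly the vertices of degree [r], and the tree degree sum
    reads [2(n - 1) = r|S| + (n - |S|)]. *)
Lemma tree_1r_card (V : finType) (H : sgraph V) r :
  1 < r -> is_1r_tree H r -> #|V| = r.-1 * #|[set x | 1 < degree H x]| + 2.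
Proof.
move=> r_gt1 [Htree Hdeg]; set S := [set x | _].
have [/connected_graphP[V_gt0 _] _] := Htree.
have H1 x : x \notin S -> degree H x = 1.
  by rewrite inE; case: (Hdeg x) => // ->; rewrite r_gt1.
have HS x : x \in S -> degree H x = r by rewrite inE; case: (Hdeg x) => // ->.
have := sum_split_card H1; rewrite (tree_degree_sum Htree) (eq_bigr _ HS).
rewrite sum_nat_const; case: r r_gt1 V_gt0 {Hdeg HS} => //= r _ V_gt0.
by rewrite mulnS [#|S| * r]mulnC; lia.
Qed.

(** Degree 0 is excluded, which rules out a single vertex; once order 2 is set aside, the order is
    at least 3, as the non-leaf argument requires. *)
Lemma is_1r_tree_card_gt1 (V : finType) (H : sgraph V) r :
  0 < r -> is_1r_tree H r -> 1 < #|V|.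
Proof.
move=> r_gt0 [[/connected_graphP[/card_gt0P[x _] _] _] /(_ x) degx].
have : 0 < degree H x by case: degx => ->.
case/card_gt0P=> y; rewrite inE => xy; apply/card_gt1P; exists x, y; split=> //.
by apply: contraTneq xy => ->; rewrite adj_irrefl.
Qed.

(** * The bound over the rationals *)

Local Open Scope ring_scope.

Theorem theorem6 (r : nat) (hr : (3 <= r)%N) (V : finType) (G : sgraph V)
    (hconn : connected_graph G) (hdeg : (max_degree G <= r)%N) :
  ((#|V|%:R - 2%:R) / (r%:R - 1) <= (gamma_c G)%:R :> rat) /\
  (#|V| <> 2%N ->
     ((gamma_c G)%:R = (#|V|%:R - 2%:R) / (r%:R - 1) :> rat
      <-> has_spanning_1r_tree G r)).
Proof.
have [[S domS SE] minS] := gamma_cP hconn.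
have r_gt0 : (0 < r)%N by apply: leq_trans hr.
have Gr x : (degree G x <= r)%N by apply: leq_trans (leq_bigmax x) hdeg.
have lb := connected_dominating_card r_gt0 Gr domS.
have rE : r%:R - 1 = r.-1%:R :> rat by rewrite -{1}(prednK r_gt0) -natr1 addrK.
have r1_gt0 : 0 < r.-1%:R :> rat by rewrite ltr0n; lia.
(* Clearing the positive denominator and moving the 2 across gives statements on naturals free of
   truncated subtraction. *)
have geE : ((#|V|%:R - 2%:R) / (r%:R - 1) <= (gamma_c G)%:R :> rat)
    = (#|V| <= r.-1 * gamma_c G + 2)%N.
  by rewrite rE ler_pdivrMr // lerBlDr -natrM -natrD ler_nat mulnC.
have eqE : ((gamma_c G)%:R == (#|V|%:R - 2%:R) / (r%:R - 1) :> rat)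
    = (#|V| == r.-1 * gamma_c G + 2)%N.
  have r1_neq0 : r.-1%:R != 0 :> rat by rewrite gt_eqF.
  rewrite rE -(inj_eq (mulIf r1_neq0)) divfK // eq_sym subr_eq.
  by rewrite -natrM -natrD eqr_nat mulnC.
split; first by rewrite geE -SE.
move=> V_neq2; split=> [/eqP|[H [HG H1r]]].
  by rewrite eqE -SE => /eqP; apply: connected_dominating_tight.
apply/eqP; rewrite eqE.
have V_gt1 := is_1r_tree_card_gt1 r_gt0 H1r.
have V_gt2 : (2 < #|V|)%N by lia.
have [[Hc _] _] := H1r.
have ub := minS _ (nonleaves_connected_dominating HG Hc V_gt2).
(* One inequality is [lb]; the other is [ub] scaled by [r.-1], with [#|V|] expressed through the
   number of non-leaves. *)
rewrite eqn_leq -{1}SE lb /= {1}(tree_1r_card (ltnW hr) H1r) leq_add2r.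
by rewrite leq_mul2l ub orbT.
Qed.
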